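(* Let $n\ge 0$, and suppose the data at time level $n$ are given and that the unknowns at level $n+1$ solve the fully discrete finite element scheme (S1)--(S11) described in the context, with time step $\Delta t>0$. Define, for $m\in\{n,n+1\}$, $$E_h^{m}=\frac12\|\mathbf u_h^{m}\|^2+|r^{m}|^2+\frac{(\Delta t)^2}{2}\|\nabla p_h^{m}\|^2 .$$ Then the discrete energy dissipation law $$\begin{aligned}\frac{E_h^{n+1}-E_h^{n}}{\Delta t}\le{}& -\frac1{Re}\|\nabla\bar{\mathbf u}_h^{n+1}\|^2-\left|\frac{r^{n+1}}{\sqrt{E_{Ph}^{n+1}+B}}\right|^2\frac{Co}{Pe}\sum_i\int_\Omega c_{ih}^{n+1}\,\big|\nabla(\log c_{ih}^{n+1}+z_i\bar V_h^{n+1})\big|^2\,d\mathbf x\\&-\frac{M}{2Wi}\left|\frac{r^{n+1}}{\sqrt{E_{Ph}^{n+1}+B}}\right|^2\int_\Omega \mathrm{tr}\big(e^{\bm\psi_h^{n+1}}+e^{-\bm\psi_h^{n+1}}-2\mathbf I\big)\,d\mathbf x\\&-\frac{\kappa M}{2}\left|\frac{r^{n+1}}{\sqrt{E_{Ph}^{n+1}+B}}\right|^2\int_\Omega\nabla\bm\psi_h^{n+1}:\nabla e^{\bm\psi_h^{n+1}}\,d\mathbf x\end{aligned}$$ holds.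
   Context: **General notation.** $\Omega\subset\mathbb R^2$ is a bounded (polygonal) domain; $(\cdot,\cdot)$ and $\|\cdot\|$ are the $L^2(\Omega)$ inner product and norm (for scalars, vectors and $2\times2$ tensors). $\mathbf I$ is the $2\times 2$ identity. For matrices, $\bm\tau:\bm\sigma=\sum_{i,j}\tau_{ij}\sigma_{ij}$; for tensor fields, $\nabla\bm\tau:\nabla\bm\sigma=\sum_k \partial_k\bm\tau:\partial_k\bm\sigma$, and $(\nabla \mathbf u)_{ij}=\partial_j u_i$. $e^{\bm\psi}$ is the matrix exponential. The index $i$ runs over finitely many ion species with constant valencies $z_i\in\mathbb R$. $Pe,Re,Co,Wi,M,\lambda,\kappa$ are positive constants. **Finite element spaces.** Let $K_h$ be a triangulation of $\bar\Omega$ into non-overlapping triangles $K$, $P_k$ polynomials of total degree $\le k$, and $L_0^2(\Omega)$ the mean-zero functions in $L^2(\Omega)$. Put $X_h=\{v\in H_0^1(\Omega)^2: v|_K\in P_2(K)^2\ \forall K\}$, $M_h=\{q\in H^1(\Omega)\cap L_0^2(\Omega): q|_K\in P_1(K)\ \forall K\}$, $Q_h=\{\varphi\in H^1(\Omega):\varphi|_K\in P_2(K)\ \forall K\}$, $S_h=Q_h\cap L_0^2(\Omega)$, $\bm V_h=\{\mathbf M\in H^1(\Omega)^{2\times2}:\mathbf M=\mathbf M^T,\ M_{ij}|_K\in P_2(K)\ \forall K\}$. It is assumed that $(X_h,M_h)$ and $(\bm V_h,X_h)$ satisfy discrete inf-sup conditions: there are $\beta_1,\beta_2>0$ with $\sup_{0\ne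 \bm u\in X_h}(q,\nabla\cdot\bm u)/\|\nabla\bm u\|\ge\beta_1\|q\|$ for all $q\in M_h$, and $\sup_{0\neq\bm\psi\in\bm V_h}(\bm\psi,\tfrac12(\nabla\bm u+\nabla\bm u^T))/\|\bm\psi\|_{\bm V_h}\ge\beta_2\|\nabla\bm u\|$ for all $\bm u\in X_h$. **Potential energy and constant $B$.** $$E_P(V,c,\bm\psi)=\int_\Omega\Big(\frac{Co}{2}\lambda|\nabla V|^2+\sum_i Co\,c_i(\log c_i-1)+\frac M2\mathrm{tr}(e^{\bm\psi}-\bm\psi-\mathbf I)\Big)d\mathbf x,$$ $E_{Ph}^{n+1}=E_P(\bar V_h^{n+1},(c_{ih}^{n+1})_i,\bm\psi_h^{n+1})$, and $B>0$ is a constant such that $E_P+B>0$ always. **Matrix decomposition.** For a $2\times 2$ matrix $\nabla\mathbf u$ and a symmetric positive definite $\bm\sigma$, write $\nabla\mathbf u=\mathbf\Omega+\mathbf B+\mathbf N\bm\sigma^{-1}$ with $\mathbf\Omega,\mathbf N$ antisymmetric and $\mathbf B$ symmetric commuting with $\bm\sigma$, chosen as follows. If $\bm\sigma$ is a multiple of $\mathbf I$: $\mathbf\Omega=0$, $\mathbf B=\mathbb D:=\frac12(\nabla\mathbf u+\nabla\mathbf u^T)$, $\mathbf N=\frac12(\nabla\mathbf u-\mathbb D)\,\mathrm{tr}\,\bm\sigma$. Otherwise, with $\mathbf R$ orthogonal, $\mathbf R^T\bm\sigma\mathbf R=\mathrm{diag}(\sigma_1,\sigma_2)$ and $(m_{ij})=\mathbf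 R^T(\nabla\mathbf u)\mathbf R$: $\mathbf B=\mathbf R\,\mathrm{diag}(m_{11},m_{22})\mathbf R^T$, $\mathbf N=\mathbf R\begin{pmatrix}0&\nu\\-\nu&0\end{pmatrix}\mathbf R^T$, $\mathbf\Omega=\mathbf R\begin{pmatrix}0&\omega\\-\omega&0\end{pmatrix}\mathbf R^T$, where $\nu=(m_{12}+m_{21})/(\sigma_2^{-1}-\sigma_1^{-1})$ and $\omega=(\sigma_2m_{12}+\sigma_1m_{21})/(\sigma_2-\sigma_1)$. In the scheme, $\mathbf\Omega_h^n,\mathbf B_h^n$ are obtained from $\nabla\mathbf u_h^n$ and $\bm\sigma=e^{\bm\psi_h^n}$. **Characteristics.** $\mathbf X(t_n)(\mathbf x)=\mathbf X^n(t^n,\mathbf x)$, where $\frac{d}{dt}\mathbf X^n(t,\mathbf x)=\mathbf u_h^n(\mathbf X^n(t,\mathbf x))$ on $[t^n,t^{n+1}]$, $\mathbf X^n(t^{n+1},\mathbf x)=\mathbf x$ (assumed well defined), and $\bm\psi_h^n\circ\mathbf X(t_n)=\bm\psi_h^n(\mathbf X(t_n))$. **Scheme.** Given $\eta_{ih}^n\in Q_h$, positive functions $c_{ih}^n$, $V_h^n\in S_h$, $\mathbf u_h^n$, $p_h^n\in M_h$, $\bm\psi_h^n\in\bm V_h$, $r^n\in\mathbb R$, find $\eta_{ih}^{n+1}\in Q_h$, $c_{ih}^{n+1}$, $\bar V_h^{n+1},V_h^{n+1}\in S_h$, $\bm\psi_h^{n+1}\in\bm V_h$, $\bar{\mathbf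 u}_h^{n+1}\in X_h$, $p_h^{n+1}\in M_h$, $\mathbf u_h^{n+1}$, $r^{n+1},\xi_h^{n+1}\in\mathbb R$ such that for all $s_{ih}\in Q_h$, $\varphi_h\in S_h$, $\bm\phi_h\in\bm V_h$, $\mathbf v_h\in X_h$, $q_h\in M_h$ (the field $\mathbf u_h^n$ is elementwise polynomial, and its gradient is understood elementwise): (S1) $\big(\frac{\eta_{ih}^{n+1}-\eta_{ih}^n}{\Delta t},s_{ih}\big)-(\mathbf u_h^n\eta_{ih}^{n+1},\nabla s_{ih})-\frac1{Pe}(\nabla\eta_{ih}^n\cdot\nabla\eta_{ih}^{n+1},s_{ih})-\frac1{Pe}(z_i\nabla\eta_{ih}^{n+1}\cdot\nabla V_h^n,s_{ih})+\frac1{Pe}(\nabla\eta_{ih}^{n+1},\nabla s_{ih})=-\frac1{Pe}(z_i\nabla V_h^n,\nabla s_{ih})$; (S2) $\bar c_{ih}^{n+1}=\exp(\eta_{ih}^{n+1})$; (S3) $c_{ih}^{n+1}=\dfrac{\int_\Omega c_{ih}^n\,d\mathbf x}{\int_\Omega\bar c_{ih}^{n+1}\,d\mathbf x}\,\bar c_{ih}^{n+1}$; (S4) $(\lambda\nabla\bar V_h^{n+1},\nabla\varphi_h)=\sum_i(z_ic_{ih}^{n+1},\varphi_h)$; (S5) $\int_\Omega\frac{\bm\psi_h^{n+1}-\bm\psi_h^n\circ\mathbf X(t_n)}{\Delta t}:\bm\phi_h\,d\mathbf x-\int_\Omega(\mathbf\Omega_h^n\bm\psi_h^{n+1}-\bm\psi_h^{n+1}\mathbf\Omega_h^n):\bm\phi_h\,d\mathbf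 x=2\int_\Omega\mathbf B_h^n:\bm\phi_h\,d\mathbf x+\frac1{Wi}\int_\Omega(e^{-\bm\psi_h^n}-\mathbf I):\bm\phi_h\,d\mathbf x-\kappa(\nabla\bm\psi_h^{n+1},\nabla\bm\phi_h)$; (S6) $\big(\frac{\bar{\mathbf u}_h^{n+1}-\mathbf u_h^n}{\Delta t},\mathbf v_h\big)+\xi_h^{n+1}((\mathbf u_h^n\cdot\nabla)\mathbf u_h^n,\mathbf v_h)+\frac1{Re}(\nabla\bar{\mathbf u}_h^{n+1},\nabla\mathbf v_h)+(\nabla p_h^n,\mathbf v_h)=-\xi_h^{n+1}(e^{\bm\psi_h^{n+1}},\nabla\mathbf v_h)-\xi_h^{n+1}\big(\sum_iCo\,z_ic_{ih}^{n+1}\nabla\bar V_h^{n+1},\mathbf v_h\big)$; (S7) $\frac1{\Delta t}(\bar{\mathbf u}_h^{n+1},\nabla q_h)=(\nabla(p_h^{n+1}-p_h^n),\nabla q_h)$; (S8) $\mathbf u_h^{n+1}=\bar{\mathbf u}_h^{n+1}-\Delta t(\nabla p_h^{n+1}-\nabla p_h^n)$; (S9) $\displaystyle\frac{r^{n+1}-r^n}{\Delta t}=\frac1{2\sqrt{E_{Ph}^{n+1}+B}}\Big(-\xi_h^{n+1}\frac{Co}{Pe}\sum_i\int_\Omega c_{ih}^{n+1}|\nabla(\log c_{ih}^{n+1}+z_i\bar V_h^{n+1})|^2d\mathbf x+\int_\Omega\sum_iCo\,z_ic_{ih}^{n+1}\bar{\mathbf u}_h^{n+1}\cdot\nabla\bar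 V_h^{n+1}d\mathbf x-\frac M{2Wi}\xi_h^{n+1}\int_\Omega\mathrm{tr}(e^{\bm\psi_h^{n+1}}+e^{-\bm\psi_h^{n+1}}-2\mathbf I)d\mathbf x+\int_\Omega(\mathbf u_h^n\cdot\nabla)\mathbf u_h^n\cdot\bar{\mathbf u}_h^{n+1}d\mathbf x+\int_\Omega\nabla\bar{\mathbf u}_h^{n+1}:e^{\bm\psi_h^{n+1}}d\mathbf x-\frac{\kappa M}2\xi_h^{n+1}\int_\Omega\nabla\bm\psi_h^{n+1}:\nabla e^{\bm\psi_h^{n+1}}d\mathbf x\Big)$; (S10) $\xi_h^{n+1}=r^{n+1}/\sqrt{E_{Ph}^{n+1}+B}$; (S11) $V_h^{n+1}=\xi_h^{n+1}\bar V_h^{n+1}$. *)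

(* Defs.v *)
From HB Require Import structures.
From mathcomp Require Import all_boot all_order all_algebra.
From mathcomp Require Import all_classical all_reals all_analysis.
Set Implicit Arguments.
Unset Strict Implicit.
Unset Printing Implicit Defensive.
Import Order.TTheory GRing.Theory Num.Theory.
Import numFieldNormedType.Exports.
Local Open Scope classical_set_scope.
Local Open Scope ring_scope.

(* Points of the plane are pairs; vector and 2 x 2 tensor fields are functions
   on all of R * R with values in 'cV[R]_2 and 'M[R]_2, and only their values
   on (the closure of) the domain are ever constrained. *)
Notation plane R := (R * R)%type.

Definition mu2 (R : realType) :
    {measure set (measurableTypeR R * measurableTypeR R) -> \bar R} :=
  (@lebesgue_measure R \x @lebesgue_measure R)%E.
Arguments mu2 R : clear implicits.

Definition coord (R : realType) (j : 'I_2) (x : plane R) : R :=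
  if j == 0 then x.1 else x.2.

Definition basis_vec (R : realType) (j : 'I_2) : plane R :=
  ((j == 0)%:R, (j == 1)%:R).

Definition partial (R : realType) (j : 'I_2) (f : plane R -> R) (x : plane R) : R :=
  'D_(basis_vec R j) f x.

Definition dotv (R : realType) (u v : 'cV[R]_2) : R := \sum_i u i 0 * v i 0.

Definition ddot (R : realType) (A B : 'M[R]_2) : R := \sum_i \sum_j A i j * B i j.

Definition expmx (R : realType) (A : 'M[R]_2) : 'M[R]_2 :=
  lim (series (fun k : nat => (k`!%:R)^-1 *: A ^+ k) @ \oo).

Definition segment (R : realType) (a b : plane R) : set (plane R) :=
  [set (1 - t) *: a + t *: b | t in `[0, 1]].

(* Equality of Om with the interior of its closure excludes slits. *)
Definition polygonal_domain (R : realType) (Om : set (plane R)) : Prop :=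
  [/\ open Om, connected Om, Om !=set0 & bounded_set Om] /\
  Om = (closure Om)° /\
  exists s : seq (plane R * plane R),
    closure Om `\` Om = \bigcup_(e in [set` s]) segment e.1 e.2.

Definition is_triangle (R : realType) (K : set (plane R)) : Prop :=
  exists a b c : plane R,
    (b.1 - a.1) * (c.2 - a.2) - (b.2 - a.2) * (c.1 - a.1) != 0 /\
    K = [set x | exists s t w : R, [/\ 0 <= s, 0 <= t, 0 <= w, s + t + w = 1
                                   & x = s *: a + t *: b + w *: c]].

Definition triangulation (R : realType) (Om : set (plane R))
    (J : finType) (K : J -> set (plane R)) : Prop :=
  [/\ forall e, is_triangle (K e),
      closure Om = \bigcup_e K e
    & forall e e', e != e' -> (K e)° `&` (K e')° = set0].

Definition L2 (R : realType) (Om : set (plane R)) (f : plane R -> R) : Prop :=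
  measurable_fun Om f /\ (mu2 R).-integrable Om (fun x => (f x ^+ 2)%:E).

Definition ip (R : realType) (Om : set (plane R)) (f g : plane R -> R) : R :=
  \int[mu2 R]_(x in Om) (f x * g x).

Definition ipv (R : realType) (Om : set (plane R)) (u v : plane R -> 'cV[R]_2) : R :=
  \int[mu2 R]_(x in Om) dotv (u x) (v x).

Definition ipt (R : realType) (Om : set (plane R)) (A B : plane R -> 'M[R]_2) : R :=
  \int[mu2 R]_(x in Om) ddot (A x) (B x).

Definition nrm (R : realType) (Om : set (plane R)) (f : plane R -> R) : R :=
  Num.sqrt (ip Om f f).

Definition nrmv (R : realType) (Om : set (plane R)) (u : plane R -> 'cV[R]_2) : R :=
  Num.sqrt (ipv Om u u).

Definition nrmt (R : realType) (Om : set (plane R)) (A : plane R -> 'M[R]_2) : R :=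
  Num.sqrt (ipt Om A A).

Fixpoint is_Ck (R : realType) (k : nat) (f : plane R -> R) : Prop :=
  if k is k'.+1 then
    (forall x, differentiable f x) /\ (forall j, is_Ck k' (partial j f))
  else continuous f.

Definition test_function (R : realType) (Om : set (plane R)) (phi : plane R -> R) : Prop :=
  (forall k, is_Ck k phi) /\
  exists C : set (plane R),
    [/\ compact C, C `<=` Om & forall x, ~ C x -> phi x = 0].

Definition weak_partial (R : realType) (Om : set (plane R)) (j : 'I_2)
    (f g : plane R -> R) : Prop :=
  forall phi, test_function Om phi -> ip Om f (partial j phi) = - ip Om g phi.

Definition H1 (R : realType) (Om : set (plane R)) (f : plane R -> R) : Prop :=
  L2 Om f /\ forall j, exists2 g, L2 Om g & weak_partial Om j f g.

Definition H10 (R : realType) (Om : set (plane R)) (f : plane R -> R) : Prop :=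
  L2 Om f /\
  exists2 g : 'I_2 -> plane R -> R,
    forall j, L2 Om (g j) /\ weak_partial Om j f (g j)
  & exists phi : nat -> plane R -> R,
      [/\ forall m, test_function Om (phi m),
          nrm Om (fun x => phi m x - f x) @[m --> \oo] --> (0 : R)
        & forall j, nrm Om (fun x => partial j (phi m) x - g j x) @[m --> \oo] --> (0 : R)].

Definition mean_zero (R : realType) (Om : set (plane R)) (f : plane R -> R) : Prop :=
  \int[mu2 R]_(x in Om) f x = 0.

Definition polyP (R : realType) (k : nat) (f : plane R -> R) : Prop :=
  exists a : nat -> nat -> R, forall x,
    f x = \sum_(i < k.+1) \sum_(j < k.+1 | (i + j <= k)%N) a i j * x.1 ^+ i * x.2 ^+ j.

Definition Pk_on (R : realType) (k : nat) (D : set (plane R)) (f : plane R -> R) : Prop :=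
  exists2 p, polyP k p & forall x, D x -> f x = p x.

(* The gradient is taken inside each triangle and set to 0 on the null set left
   over.  For a function in H^1 that is smooth in each triangle it is a
   representative of the weak gradient. *)
Definition epartial (R : realType) (J : finType) (K : J -> set (plane R))
    (j : 'I_2) (f : plane R -> R) : plane R -> R :=
  patch (fun=> 0) (\bigcup_e (K e)°) (partial j f).

Definition egrad (R : realType) (J : finType) (K : J -> set (plane R))
    (f : plane R -> R) (x : plane R) : 'cV[R]_2 :=
  \col_j epartial K j f x.

Definition egradv (R : realType) (J : finType) (K : J -> set (plane R))
    (u : plane R -> 'cV[R]_2) (x : plane R) : 'M[R]_2 :=
  \matrix_(i, j) epartial K j (fun y => u y i 0) x.

Definition epartialt (R : realType) (J : finType) (K : J -> set (plane R))
    (k : 'I_2) (A : plane R -> 'M[R]_2) (x : plane R) : 'M[R]_2 :=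
  \matrix_(i, j) epartial K k (fun y => A y i j) x.

Definition gradt_ddot (R : realType) (J : finType) (K : J -> set (plane R))
    (A B : plane R -> 'M[R]_2) (x : plane R) : R :=
  \sum_k ddot (epartialt K k A x) (epartialt K k B x).

Definition ediv (R : realType) (J : finType) (K : J -> set (plane R))
    (u : plane R -> 'cV[R]_2) (x : plane R) : R := \tr (egradv K u x).

Definition symgrad (R : realType) (J : finType) (K : J -> set (plane R))
    (u : plane R -> 'cV[R]_2) (x : plane R) : 'M[R]_2 :=
  2^-1 *: (egradv K u x + (egradv K u x)^T).

(* (u . grad) u, since (grad u)_ij = d_j u_i *)
Definition convect (R : realType) (J : finType) (K : J -> set (plane R))
    (u : plane R -> 'cV[R]_2) (x : plane R) : 'cV[R]_2 :=
  egradv K u x *m u x.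

(* In the H^1-conforming spaces below, requiring polynomials on the closed
   triangles selects the continuous representative. *)

Definition Xh (R : realType) (Om : set (plane R)) (J : finType) (K : J -> set (plane R))
    (v : plane R -> 'cV[R]_2) : Prop :=
  forall i, H10 Om (fun x => v x i 0) /\ forall e, Pk_on 2 (K e) (fun x => v x i 0).

Definition Mh (R : realType) (Om : set (plane R)) (J : finType) (K : J -> set (plane R))
    (q : plane R -> R) : Prop :=
  [/\ H1 Om q, mean_zero Om q & forall e, Pk_on 1 (K e) q].

Definition Qh (R : realType) (Om : set (plane R)) (J : finType) (K : J -> set (plane R))
    (f : plane R -> R) : Prop :=
  H1 Om f /\ forall e, Pk_on 2 (K e) f.

Definition Sh (R : realType) (Om : set (plane R)) (J : finType) (K : J -> set (plane R))
    (f : plane R -> R) : Prop :=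
  Qh Om K f /\ mean_zero Om f.

Definition Vh (R : realType) (Om : set (plane R)) (J : finType) (K : J -> set (plane R))
    (A : plane R -> 'M[R]_2) : Prop :=
  (forall x, closure Om x -> (A x)^T = A x) /\
  forall i j, H1 Om (fun x => A x i j) /\ forall e, Pk_on 2 (K e) (fun x => A x i j).

(* The space of the corrected velocity: square integrable, polynomial in the
   interior of each triangle, possibly discontinuous across edges. *)
Definition broken_poly (R : realType) (Om : set (plane R)) (J : finType)
    (K : J -> set (plane R)) (v : plane R -> 'cV[R]_2) : Prop :=
  exists k : nat, forall i, L2 Om (fun x => v x i 0) /\
    forall e, Pk_on k (K e)° (fun x => v x i 0).

Definition nonzero_on (R : realType) (T : nmodType) (Om : set (plane R))
    (f : plane R -> T) : Prop := exists2 x, Om x & f x <> 0.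

Definition inf_sup_XM (R : realType) (Om : set (plane R)) (J : finType)
    (K : J -> set (plane R)) : Prop :=
  exists2 beta : R, 0 < beta &
    forall q, Mh Om K q ->
      ((beta * nrm Om q)%:E <=
       ereal_sup [set (ip Om q (ediv K u) / nrmt Om (egradv K u))%:E
                 | u in [set u | Xh Om K u /\ nonzero_on Om u]])%E.

(* The norm of V_h as a subspace of H^1.  The choice of norm is immaterial here:
   V_h is finite dimensional and beta is existentially quantified. *)
Definition nrmVh (R : realType) (Om : set (plane R)) (J : finType)
    (K : J -> set (plane R)) (A : plane R -> 'M[R]_2) : R :=
  Num.sqrt (ipt Om A A + \int[mu2 R]_(x in Om) gradt_ddot K A A x).

Definition inf_sup_VX (R : realType) (Om : set (plane R)) (J : finType)
    (K : J -> set (plane R)) : Prop :=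
  exists2 beta : R, 0 < beta &
    forall u, Xh Om K u ->
      ((beta * nrmt Om (egradv K u))%:E <=
       ereal_sup [set (ipt Om A (symgrad K u) / nrmVh Om K A)%:E
                 | A in [set A | Vh Om K A /\ nonzero_on Om A]])%E.

Definition EP (R : realType) (Om : set (plane R)) (J : finType) (K : J -> set (plane R))
    (I : finType) (Co M lam : R) (V : plane R -> R) (c : I -> plane R -> R)
    (psi : plane R -> 'M[R]_2) : R :=
  \int[mu2 R]_(x in Om)
    (Co / 2 * lam * dotv (egrad K V x) (egrad K V x)
     + \sum_i Co * c i x * (ln (c i x) - 1)
     + M / 2 * \tr (expmx (psi x) - psi x - 1%:M)).

Definition diag2 (R : realType) (a b : R) : 'M[R]_2 :=
  \matrix_(i, j) (if i == j then (if i == 0 then a else b) else 0).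

Definition antisym2 (R : realType) (w : R) : 'M[R]_2 :=
  \matrix_(i, j) (if i == j then 0 else if i == 0 then w else - w).

(* G = W + B + N *m invmx sigma, with W, N antisymmetric and B symmetric
   commuting with sigma; W and B are the tensors written Omega and B in the
   log-conformation equation. *)
Definition decomposition (R : realType) (G sigma W B N : 'M[R]_2) : Prop :=
  ((exists a : R, sigma = a%:M) ->
     [/\ W = 0,
         B = 2^-1 *: (G + G^T)
       & N = (2^-1 * \tr sigma) *: (G - 2^-1 *: (G + G^T))]) /\
  (~ (exists a : R, sigma = a%:M) ->
     exists (Q : 'M[R]_2) (s1 s2 : R),
       let m := Q^T *m G *m Q in
       [/\ Q^T *m Q = 1%:M,
           Q^T *m sigma *m Q = diag2 s1 s2,
           B = Q *m diag2 (m 0 0) (m 1 1) *m Q^T,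
           N = Q *m antisym2 ((m 0 1 + m 1 0) / (s2^-1 - s1^-1)) *m Q^T
         & W = Q *m antisym2 ((s2 * m 0 1 + s1 * m 1 0) / (s2 - s1)) *m Q^T]).

(* X t x is the position at time t of the trajectory that is at x at time t1.
   The field u may jump across edges, where trajectories have kinks, so
   finitely many exceptional times are allowed on each trajectory. *)
Definition characteristics (R : realType) (Om : set (plane R))
    (u : plane R -> 'cV[R]_2) (t0 t1 : R) (X : R -> plane R -> plane R) : Prop :=
  forall x, Om x ->
    [/\ X t1 x = x,
        forall t, t0 <= t <= t1 -> closure Om (X t x),
        {within `[t0, t1], continuous (fun t => X t x)}
      & exists F : seq R, forall t, t0 < t < t1 -> t \notin F ->
          forall j, is_derive t (1 : R) (fun s => coord j (X s x)) (u (X t x) j 0)].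

(* Main.v *)
(* Testing the momentum equation with ubar and the projection equation with
   p^n and p^{n+1} turns the pressure gradient into telescoping terms: since
   u^{n+1} = ubar - dt grad(p^{n+1} - p^n),
     ((ubar - u^n)/dt, ubar) + (grad p^n, ubar)
       = (|u^{n+1}|^2 - |u^n|^2 + |ubar - u^n|^2)/(2 dt)
         + dt/2 (|grad p^{n+1}|^2 - |grad p^n|^2).
   Multiplying the equation for r by 2 r^{n+1} makes the factor xi appear in
   front of every coupling term, so the convection, elastic and electric terms
   cancel against those of the momentum equation.  What is dropped is
   |ubar - u^n|^2 and (r^{n+1} - r^n)^2. *)

Require Import Defs.
From HB Require Import structures.
From mathcomp Require Import all_boot all_order all_algebra.
From mathcomp Require Import all_classical all_reals all_analysis.
From mathcomp Require Import measurable_realfun ring lra.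
Import Order.TTheory GRing.Theory Num.Theory.
Import numFieldNormedType.Exports.
Local Open Scope classical_set_scope.
Local Open Scope ring_scope.

(* The same sigma-algebra as on [plane R], under the measure display of [mu2 R];
   the two displays are not convertible. *)
Local Notation mplane R := (measurableTypeR R * measurableTypeR R)%type.

(** * Measurability and finite measure of the domain *)

(** [mplane R] carries the product sigma-algebra, so open sets are reached through rectangles: an
    open set is the countable union of the rational boxes it contains. *)
Lemma open_measurable_plane (R : realType) (U : set (plane R)) :
  open U -> @measurable _ (mplane R) U.
Proof.
move=> oU.
pose box (q : (rat * rat) * (rat * rat)) : set (plane R) :=
  [set x | ratr q.1.1 < x.1 < ratr q.1.2 /\ ratr q.2.1 < x.2 < ratr q.2.2].
have -> : U = \bigcup_(q in [set q | box q `<=` U]) box q.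
  apply/seteqP; split=> [x Ux|x [q /= qU qx]]; last exact: qU.
  have /nbhs_ballP[e /= e0 eU] := open_nbhs_nbhs (conj oU Ux).
  have near_rat (y : R) : exists q : rat * rat, ratr q.1 < y < ratr q.2 /\
      forall w : R, ratr q.1 < w < ratr q.2 -> Num.norm (y - w) < e.
    have [|a] := @rat_in_itvoo R (y - e) y; first lra.
    have [|b] := @rat_in_itvoo R y (y + e); first lra.
    rewrite !in_itv /= => /andP[yb be] /andP[ea ay]; exists (a, b).
    split=> [|w /=]; first by rewrite ay.
    move=> /andP[aw wb]; rewrite ltr_norml; apply/andP; split; lra.
  have [q1 [x1 Hq1]] := near_rat x.1; have [q2 [x2 Hq2]] := near_rat x.2.
  exists (q1, q2) => //= w [/= w1 w2]; apply: eU.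
  by split; rewrite /ball /=; [exact: Hq1|exact: Hq2].
rewrite bigcup_mkcond; apply: countable_bigcupT_measurable => // q.
case: ifP => // _.
have mI (a b : R) : measurable [set y : R | a < y < b].
  by have := measurable_itv `]a, b[; rewrite set_itvoo.
exact: measurableX (mI _ _) (mI _ _).
Qed.

Lemma plane_bounded_finite_measure (R : realType) (U : set (plane R)) :
  @measurable _ (mplane R) U -> bounded_set U -> (mu2 R U < +oo)%E.
Proof.
move=> mU [M0 [_ bU]].
(* Boundedness provides a bound by every real strictly above [M0], hence the [+ 1]. The norm is the
   max norm, so the ball sits in a square. *)
pose M : R := `|M0| + 1; pose I : set R := `[- M, M]%classic.
have UM : U `<=` I `*` I.
  move=> x Ux; have := bU M; rewrite /M (le_lt_trans (ler_norm _)) ?ltrDl//.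
  move=> /(_ isT x Ux) /=; rewrite prod_normE ge_max => /andP[].
  by rewrite !ler_norml /I => ? ?; split; rewrite /= in_itv.
apply: (@le_lt_trans _ _ (mu2 R (I `*` I))).
  by apply: le_measure => //; rewrite inE //; apply: measurableX; exact: measurable_itv.
have -> : mu2 R (I `*` I) =
    (lebesgue_measure I * lebesgue_measure I)%E.
  by apply: product_measure1E; exact: measurable_itv.
rewrite !lebesgue_measure_itv /=.
by case: ifPn => _; rewrite ?mule0// -!EFinD -EFinM ltry.
Qed.

(** * Derivatives of affine functions of two variables *)

Lemma affine_is_derive (R : realType) (a b d : R) (x v : plane R) :
  is_derive x v (fun y : plane R => a + b * y.1 + d * y.2) (b * v.1 + d * v.2).
Proof.
have cvgD : h^-1 *: ((fun y : plane R => a + b * y.1 + d * y.2) (h *: v + x)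
    (* The difference quotient is constant for [h != 0]. *)
    - (a + b * x.1 + d * x.2)) @[h --> (0:R)^'] --> b * v.1 + d * v.2.
  apply: cvg_near_cst; near=> h.
  have h0 : h != 0 by near: h; exact: nbhs_dnbhs_neq.
  rewrite /= /GRing.scale /=; field.
  exact: h0.
split; last exact: cvg_lim.
by apply/cvg_ex; exists (b * v.1 + d * v.2).
Unshelve. all: by end_near. Qed.

Lemma P1_is_derive (R : realType) (D : set (plane R)) (f : plane R -> R) :
  Pk_on 1 D f ->
  exists a : 'I_2 -> R, forall x j, D° x -> is_derive x (basis_vec R j) f (a j).
Proof.
move=> [q [a aq] fq].
(* Pairing the two linear coefficients with the basis vector selects the one in direction [j]. The
   value does not depend on the point. *)
exists (fun j => a 1%N 0%N * (basis_vec R j).1 + a 0%N 1%N * (basis_vec R j).2).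
move=> x j Dx.
have := affine_is_derive _ (a 0%N 0%N) (a 1%N 0%N) (a 0%N 1%N) x (basis_vec R j).
apply: near_eq_is_derive.
apply: filterS Dx => y Dy; rewrite fq// aq.
under eq_bigr do rewrite big_mkcond.
by rewrite !big_ord_recl !big_ord0 /=; ring.
Qed.

(** * Square integrable fields and bilinearity of their inner products *)

Section square_integrable.
Context d (T : measurableType d) (R : realType) (mu : {measure set T -> \bar R}).
Variables (D : set T) (mD : measurable D).

Lemma integrable_mul (f g : T -> R) :
  measurable_fun D f -> mu.-integrable D (EFin \o (fun x => f x ^+ 2)) ->
  measurable_fun D g -> mu.-integrable D (EFin \o (fun x => g x ^+ 2)) ->
  mu.-integrable D (EFin \o (fun x => f x * g x)).
Proof.
move=> mf if2 mg ig2.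
apply: (le_integrable mD _ _ (integrableD mD if2 ig2)).
  by apply/measurable_EFinP; exact: measurable_funM.
move=> x Dx; rewrite /= lee_fin [leRHS]ger0_norm ?addr_ge0 ?sqr_ge0//.
(* These two squares give the domination of [|f x * g x|] by [f x ^+ 2 + g x ^+ 2]. *)
have [fp fn] := (sqr_ge0 (f x + g x), sqr_ge0 (f x - g x)).
rewrite ler_norml; apply/andP; split; nra.
Qed.

End square_integrable.

Section L2_space.
Context (R : realType) (Om : set (plane R)) (mOm : @measurable _ (mplane R) Om).
Local Notation mu := (mu2 R).

Lemma L2_measurable (f : plane R -> R) : L2 Om f ->
  @measurable_fun _ _ (mplane R) R Om f.
Proof. by case. Qed.

Lemma L2_mul_integrable (f g : plane R -> R) :
  L2 Om f -> L2 Om g -> mu.-integrable Om (EFin \o (fun x => f x * g x)).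
Proof.
move=> Lf Lg; apply: integrable_mul => //;
  by [exact: L2_measurable | case: Lf | case: Lg].
Qed.

Lemma L2Z (a : R) (f : plane R -> R) : L2 Om f -> L2 Om (fun x => a * f x).
Proof.
move=> Lf; split.
  exact: (measurable_funM (measurable_cst a) (L2_measurable _ Lf)).
have := integrableZl mOm (a ^+ 2) Lf.2.
by apply: eq_integrable => // x _; rewrite -EFinM -exprMn.
Qed.

Lemma L2B (f g : plane R -> R) : L2 Om f -> L2 Om g -> L2 Om (fun x => f x - g x).
Proof.
move=> Lf Lg; split.
  exact: (measurable_funB (L2_measurable _ Lf) (L2_measurable _ Lg)).
have := integrableB mOm (integrableD mOm Lf.2 Lg.2)
  (integrableZl mOm 2 (L2_mul_integrable _ _ Lf Lg)).
apply: eq_integrable => // x _ /=.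
by congr EFin; ring.
Qed.

Lemma bounded_L2 (f : plane R -> R) : (mu Om < +oo)%E ->
  @measurable_fun _ _ (mplane R) R Om f -> [bounded f x | x in Om] -> L2 Om f.
Proof.
move=> fin mf [M [rM bf]]; split=> //.
apply: (measurable_bounded_integrable mOm fin); first exact: measurable_funM.
exists ((`|M| + 1) ^+ 2); split=> [|N MN]; first exact: num_real.
move=> x Omx /=; apply: (le_trans _ (ltW MN)).
rewrite normrX; apply: lerXn2r; rewrite ?nnegrE ?addr_ge0//.
by apply: bf => //; rewrite (le_lt_trans (ler_norm _)) ?ltrDl.
Qed.

Lemma ipZl (a : R) (f g : plane R -> R) : L2 Om f -> L2 Om g ->
  ip Om (fun x => a * f x) g = a * ip Om f g.
Proof.
move=> Lf Lg; rewrite /ip -RintegralZl//; last exact: L2_mul_integrable.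
by apply: eq_Rintegral => x _; rewrite mulrA.
Qed.

Lemma ipBl (f g h : plane R -> R) : L2 Om f -> L2 Om g -> L2 Om h ->
  ip Om (fun x => f x - g x) h = ip Om f h - ip Om g h.
Proof.
move=> Lf Lg Lh; rewrite /ip -RintegralB//; try exact: L2_mul_integrable.
by apply: eq_Rintegral => x _; rewrite mulrBl.
Qed.

Definition L2v (u : plane R -> 'cV[R]_2) : Prop := forall i, L2 Om (fun x => u x i 0).

Lemma L2vB (u v : plane R -> 'cV[R]_2) : L2v u -> L2v v -> L2v (fun x => u x - v x).
Proof. by move=> Lu Lv i; under eq_fun do rewrite !mxE; exact: L2B. Qed.

Lemma L2vZ (a : R) (u : plane R -> 'cV[R]_2) : L2v u -> L2v (fun x => a *: u x).
Proof. by move=> Lu i; under eq_fun do rewrite !mxE; exact: L2Z. Qed.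

Lemma ipvE (u v : plane R -> 'cV[R]_2) : L2v u -> L2v v ->
  ipv Om u v = \sum_i ip Om (fun x => u x i 0) (fun x => v x i 0).
Proof.
move=> Lu Lv; rewrite !big_ord_recl big_ord0 addr0 /ip -RintegralD//;
  try exact: (L2_mul_integrable _ _ (Lu _) (Lv _)).
by apply: eq_Rintegral => x _; rewrite /dotv !big_ord_recl big_ord0 addr0.
Qed.

Lemma ipvC (u v : plane R -> 'cV[R]_2) : ipv Om u v = ipv Om v u.
Proof.
by apply: eq_Rintegral => x _; apply: eq_bigr => i _; rewrite mulrC.
Qed.

Lemma ipvBl (u v w : plane R -> 'cV[R]_2) : L2v u -> L2v v -> L2v w ->
  ipv Om (fun x => u x - v x) w = ipv Om u w - ipv Om v w.
Proof.
move=> Lu Lv Lw; rewrite !ipvE//; last exact: L2vB.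
rewrite -sumrB; apply: eq_bigr => i _; rewrite -ipBl//.
by congr ip; apply/funext => x; rewrite !mxE.
Qed.

Lemma ipvZl (a : R) (u v : plane R -> 'cV[R]_2) : L2v u -> L2v v ->
  ipv Om (fun x => a *: u x) v = a * ipv Om u v.
Proof.
move=> Lu Lv; rewrite !ipvE//; last exact: L2vZ.
rewrite mulr_sumr; apply: eq_bigr => i _; rewrite -ipZl//.
by congr ip; apply/funext => x; rewrite !mxE.
Qed.

Lemma ipvBr (u v w : plane R -> 'cV[R]_2) : L2v u -> L2v v -> L2v w ->
  ipv Om w (fun x => u x - v x) = ipv Om w u - ipv Om w v.
Proof. by move=> *; rewrite ipvC ipvBl// !(ipvC w). Qed.

Lemma ipvZr (a : R) (u v : plane R -> 'cV[R]_2) : L2v u -> L2v v ->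
  ipv Om v (fun x => a *: u x) = a * ipv Om v u.
Proof. by move=> *; rewrite ipvC ipvZl// !(ipvC v). Qed.

Lemma dotv_ge0 (a : 'cV[R]_2) : 0 <= dotv a a.
Proof. by apply: sumr_ge0 => i _; rewrite -expr2 sqr_ge0. Qed.

Lemma ddot_ge0 (A : 'M[R]_2) : 0 <= ddot A A.
Proof. by apply: sumr_ge0 => i _; apply: sumr_ge0 => j _; rewrite -expr2 sqr_ge0. Qed.

Lemma ipv_ge0 (u : plane R -> 'cV[R]_2) : 0 <= ipv Om u u.
Proof. by apply: Rintegral_ge0 => x _; exact: dotv_ge0. Qed.

Lemma sqr_nrmv (u : plane R -> 'cV[R]_2) : nrmv Om u ^+ 2 = ipv Om u u.
Proof. by rewrite sqr_sqrtr// ipv_ge0. Qed.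

Lemma sqr_nrmt (A : plane R -> 'M[R]_2) : nrmt Om A ^+ 2 = ipt Om A A.
Proof. by rewrite sqr_sqrtr//; apply: Rintegral_ge0 => x _; exact: ddot_ge0. Qed.

(** Allows the velocity correction, known only almost everywhere, to be substituted inside a
    norm. *)
Lemma ae_eq_ipv (u v : plane R -> 'cV[R]_2) : L2v u -> L2v v ->
  {ae mu, forall x, Om x -> u x = v x} -> ipv Om u u = ipv Om v v.
Proof.
move=> Lu Lv uv; rewrite !ipvE//; apply: eq_bigr => i _; congr fine.
apply: ae_eq_integral => //.
- by apply/measurable_EFinP; apply: measurable_funM; exact: L2_measurable.
- by apply/measurable_EFinP; apply: measurable_funM; exact: L2_measurable.
case: uv => N [mN N0 sN]; exists N; split=> // x /= nx.
by apply: sN => /= uvx; apply: nx => Omx; rewrite uvx.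
Qed.

End L2_space.

(** * Elementwise gradients of piecewise affine functions *)

Section broken_gradient.
Context (R : realType) (J : finType) (K : J -> set (plane R)).

Lemma P1_epartial_cst (f : plane R -> R) : (forall e, Pk_on 1 (K e) f) ->
  exists a : J -> 'I_2 -> R, forall e j x, (K e)° x -> epartial K j f x = a e j.
Proof.
move=> Pf; have [a fa] := choice (fun e => P1_is_derive _ _ _ (Pf e)).
exists a => e j x Kx.
rewrite /epartial patchE ifT; last by rewrite inE; exists e.
by have [_ <-] := fa e x j Kx.
Qed.

(** Additivity of the derivative needs differentiability, which the affine form supplies inside each
    triangle; everywhere else all three values are patched to 0. *)
Lemma epartialB (f g : plane R -> R) (j : 'I_2) (x : plane R) :
  (forall e, Pk_on 1 (K e) f) -> (forall e, Pk_on 1 (K e) g) ->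
  epartial K j (fun y => f y - g y) x = epartial K j f x - epartial K j g x.
Proof.
move=> Pf Pg; rewrite /epartial !patchE; case: ifPn => [|_]; last by rewrite subrr.
rewrite inE => -[e _ Kx].
have [a /(_ x j Kx)[df _]] := P1_is_derive _ _ _ (Pf e).
have [b /(_ x j Kx)[dg _]] := P1_is_derive _ _ _ (Pg e).
exact: deriveB.
Qed.

Lemma egradB (f g : plane R -> R) :
  (forall e, Pk_on 1 (K e) f) -> (forall e, Pk_on 1 (K e) g) ->
  egrad K (fun y => f y - g y) = (fun x => egrad K f x - egrad K g x).
Proof.
by move=> Pf Pg; apply/funext => x; apply/matrixP => j k; rewrite !mxE epartialB.
Qed.

(** The gradient takes finitely many values, one per open triangle and 0 elsewhere, so it is bounded
    and measurable on a set of finite measure. *)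
Lemma P1_egrad_L2v (Om : set (plane R)) (f : plane R -> R) :
  @measurable _ (mplane R) Om -> (mu2 R Om < +oo)%E ->
  (forall e, Pk_on 1 (K e) f) -> L2v _ Om (egrad K f).
Proof.
move=> mOm fin Pf j; under eq_fun do rewrite mxE.
have [a fa] := P1_epartial_cst f Pf.
pose U := \bigcup_e (K e)°.
have f0 x : ~ U x -> epartial K j f x = 0.
  by move=> Ux; rewrite /epartial patchE memNset.
have mK e : @measurable _ (mplane R) (K e)°.
  by apply: open_measurable_plane; exact: open_interior.
apply: bounded_L2 => //.
- move=> _ Y mY; apply: measurableI => //.
  have -> : epartial K j f @^-1` Y =
      \bigcup_(e in [set e | Y (a e j)]) (K e)° `|` (if 0 \in Y then ~` U else set0).
    apply/seteqP; split=> x /=.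
      have [[e _ Ke]|Ux] := pselect (U x).
        by rewrite (fa e)// => Ya; left; exists e.
      by rewrite f0// => Y0; right; rewrite mem_set.
    move=> [[e /= Ye Ke]|]; first by rewrite (fa e).
    by case: ifPn => // /set_mem Y0 Ux; rewrite f0.
  apply: measurableU; first exact: fin_bigcup_measurable.
  case: ifP => // _; apply: measurableC; exact: fin_bigcup_measurable.
(* The sum over all triangles dominates each single value and is nonnegative, which also covers the
   value 0. *)
- exists (\sum_e `|a e j|); split=> [|M aM x _ /=]; first exact: num_real.
  apply: (le_trans _ (ltW aM)).
  have [[e _ Ke]|Ux] := pselect (U x); last by rewrite f0// normr0 sumr_ge0.
  by rewrite (fa e)// (bigD1 e)//= lerDl sumr_ge0.
Qed.

End broken_gradient.

(** * Energy relations for the projection step and the auxiliary variable *)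

(** Here [g] and [g'] stand for the old and new pressure gradients, and the last two premises are
    the projection equation tested with the two pressures. *)
Lemma projection_energy (R : realType) (Om : set (plane R))
    (u u' ub g g' : plane R -> 'cV[R]_2) (dt : R) :
  @measurable _ (mplane R) Om -> dt != 0 ->
  L2v _ Om u -> L2v _ Om u' -> L2v _ Om ub -> L2v _ Om g -> L2v _ Om g' ->
  {ae mu2 R, forall x, Om x -> u' x = ub x - dt *: (g' x - g x)} ->
  dt^-1 * ipv Om ub g = ipv Om (fun x => g' x - g x) g ->
  dt^-1 * ipv Om ub g' = ipv Om (fun x => g' x - g x) g' ->
  ipv Om (fun x => dt^-1 *: (ub x - u x)) ub + ipv Om g ub =
  (2 * dt)^-1 * (ipv Om u' u' - ipv Om u u
                 + ipv Om (fun x => ub x - u x) (fun x => ub x - u x))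
  + dt / 2 * (ipv Om g' g' - ipv Om g g).
Proof.
move=> mOm dt0 Lu Lu' Lub Lg Lg' u'E.
have Ldu := L2vB _ _ mOm _ _ Lub Lu.
have Ldg := L2vB _ _ mOm _ _ Lg' Lg.
have Lddg := L2vZ _ _ mOm dt _ Ldg.
have Lu'' := L2vB _ _ mOm _ _ Lub Lddg.
rewrite (ae_eq_ipv _ _ mOm _ _ Lu' Lu'' u'E).
(* The goal and both remaining premises are expanded into inner products of [u], [ub], [g] and [g'].
   The premises, scaled by [dt], then eliminate the products of [ub] with [g] and [g']. *)
rewrite !(ipvZl, ipvZr, ipvBl, ipvBr)//.
rewrite (ipvC _ _ g ub) (ipvC _ _ g' ub) (ipvC _ _ u ub) (ipvC _ _ g g').
move=> /(congr1 ( *%R dt)); rewrite mulVKf// => ->.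
move=> /(congr1 ( *%R dt)); rewrite mulVKf// => ->.
by field.
Qed.

(** The bound is [r' ^+ 2 - r ^+ 2 <= 2 * r' * (r' - r)], whose defect is [(r' - r) ^+ 2]; the
    factor [r' / s] becomes [xi]. *)
Lemma auxiliary_variable_energy (R : realFieldType) (r r' s G dt : R) : 0 < dt ->
  (r' - r) / dt = (2 * s)^-1 * G -> (r' ^+ 2 - r ^+ 2) / dt <= r' / s * G.
Proof.
move=> dt0 rG.
(* [(2 * s)^-1] also cancels the factor 2 when [s = 0], as [0^-1 = 0]. *)
have -> : r' / s * G = 2 * r' * ((r' - r) / dt).
  by rewrite rG invfM; move: s^-1 => t; field.
by rewrite mulrA ler_pM2r ?invr_gt0//; have := sqr_ge0 (r' - r); nra.
Qed.

(** * Assembly of the tested equations into the dissipation law *)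

Theorem theorem3 (R : realType)
  (Om : set (plane R)) (J : finType) (K : J -> set (plane R))
  (I : finType) (z : I -> R)
  (Pe Re Co Wi M lam kap B dt : R) (t : nat -> R) (n : nat)
  (eta c cbar : nat -> I -> plane R -> R) (V Vbar p : nat -> plane R -> R)
  (u ubar : nat -> plane R -> 'cV[R]_2) (psi : nat -> plane R -> 'M[R]_2)
  (r xi : nat -> R)
  (X : R -> plane R -> plane R) (W D N : plane R -> 'M[R]_2) :
  let mu := mu2 R in
  let EPh := EP Om K Co M lam (Vbar n.+1) (c n.+1) (psi n.+1) in
  (* domain, triangulation, inf-sup conditions, constants *)
  polygonal_domain Om -> triangulation Om K ->
  inf_sup_XM Om K -> inf_sup_VX Om K ->
  0 < Pe -> 0 < Re -> 0 < Co -> 0 < Wi -> 0 < M -> 0 < lam -> 0 < kap -> 0 < dt ->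
  0 < B ->
  (forall (V' : plane R -> R) (c' : I -> plane R -> R) (psi' : plane R -> 'M[R]_2),
     Sh Om K V' ->
     (forall i, (forall x, Om x -> 0 < c' i x) /\
        mu.-integrable Om (fun x => (c' i x * (ln (c' i x) - 1))%:E)) ->
     Vh Om K psi' ->
     0 < EP Om K Co M lam V' c' psi' + B) ->
  t n.+1 = t n + dt ->
  (* data at level n *)
  (forall i, Qh Om K (eta n i)) ->
  (forall i, (forall x, Om x -> 0 < c n i x) /\
     mu.-integrable Om (fun x => (c n i x)%:E)) ->
  Sh Om K (V n) -> broken_poly Om K (u n) -> Mh Om K (p n) -> Vh Om K (psi n) ->
  (* unknowns at level n+1 *)
  (forall i, Qh Om K (eta n.+1 i)) ->
  Sh Om K (Vbar n.+1) -> Sh Om K (V n.+1) -> Vh Om K (psi n.+1) ->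
  Xh Om K (ubar n.+1) -> Mh Om K (p n.+1) -> broken_poly Om K (u n.+1) ->
  (* characteristics, and decomposition of the velocity gradient *)
  characteristics Om (u n) (t n) (t n.+1) X ->
  {ae mu, forall x, Om x ->
     decomposition (egradv K (u n) x) (expmx (psi n x)) (W x) (D x) (N x)} ->
  (* S1 *)
  (forall (i : I) (s : plane R -> R), Qh Om K s ->
     ip Om (fun x => (eta n.+1 i x - eta n i x) / dt) s
     - ipv Om (fun x => eta n.+1 i x *: u n x) (egrad K s)
     - Pe^-1 * ip Om (fun x => dotv (egrad K (eta n i) x) (egrad K (eta n.+1 i) x)) s
     - Pe^-1 * ip Om (fun x => z i * dotv (egrad K (eta n.+1 i) x) (egrad K (V n) x)) s
     + Pe^-1 * ipv Om (egrad K (eta n.+1 i)) (egrad K s)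
     = - (Pe^-1 * ipv Om (fun x => z i *: egrad K (V n) x) (egrad K s))) ->
  (* S2 *)
  (forall i x, Om x -> cbar n.+1 i x = expR (eta n.+1 i x)) ->
  (* S3 *)
  (forall i x, Om x ->
     c n.+1 i x = (\int[mu]_(y in Om) c n i y) / (\int[mu]_(y in Om) cbar n.+1 i y)
                  * cbar n.+1 i x) ->
  (* S4 *)
  (forall phi : plane R -> R, Sh Om K phi ->
     ipv Om (fun x => lam *: egrad K (Vbar n.+1) x) (egrad K phi)
     = \sum_i ip Om (fun x => z i * c n.+1 i x) phi) ->
  (* S5 *)
  (forall phi : plane R -> 'M[R]_2, Vh Om K phi ->
     ipt Om (fun x => dt^-1 *: (psi n.+1 x - psi n (X (t n) x))) phi
     - ipt Om (fun x => W x *m psi n.+1 x - psi n.+1 x *m W x) phi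
     = 2 * ipt Om D phi
       + Wi^-1 * ipt Om (fun x => expmx (- psi n x) - 1%:M) phi
       - kap * \int[mu]_(x in Om) gradt_ddot K (psi n.+1) phi x) ->
  (* S6 *)
  (forall v : plane R -> 'cV[R]_2, Xh Om K v ->
     ipv Om (fun x => dt^-1 *: (ubar n.+1 x - u n x)) v
     + xi n.+1 * ipv Om (convect K (u n)) v
     + Re^-1 * ipt Om (egradv K (ubar n.+1)) (egradv K v)
     + ipv Om (egrad K (p n)) v
     = - (xi n.+1 * ipt Om (fun x => expmx (psi n.+1 x)) (egradv K v))
       - xi n.+1 *
         ipv Om (fun x => \sum_i (Co * z i * c n.+1 i x) *: egrad K (Vbar n.+1) x) v) ->
  (* S7 *)
  (forall q : plane R -> R, Mh Om K q ->
     dt^-1 * ipv Om (ubar n.+1) (egrad K q)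
     = ipv Om (egrad K (fun x => p n.+1 x - p n x)) (egrad K q)) ->
  (* S8 *)
  {ae mu, forall x, Om x ->
     u n.+1 x = ubar n.+1 x - dt *: (egrad K (p n.+1) x - egrad K (p n) x)} ->
  (* S9 *)
  (r n.+1 - r n) / dt
  = (2 * Num.sqrt (EPh + B))^-1 *
    (- (xi n.+1 * (Co / Pe) *
        \sum_i \int[mu]_(x in Om)
          (c n.+1 i x *
           dotv (egrad K (fun y => ln (c n.+1 i y) + z i * Vbar n.+1 y) x)
                (egrad K (fun y => ln (c n.+1 i y) + z i * Vbar n.+1 y) x)))
     + \int[mu]_(x in Om)
         (\sum_i Co * z i * c n.+1 i x * dotv (ubar n.+1 x) (egrad K (Vbar n.+1) x))
     - M / (2 * Wi) * xi n.+1 *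
       \int[mu]_(x in Om) \tr (expmx (psi n.+1 x) + expmx (- psi n.+1 x) - 2%:M)
     + \int[mu]_(x in Om) dotv (convect K (u n) x) (ubar n.+1 x)
     + \int[mu]_(x in Om) ddot (egradv K (ubar n.+1) x) (expmx (psi n.+1 x))
     - kap * M / 2 * xi n.+1 *
       \int[mu]_(x in Om)
         gradt_ddot K (psi n.+1) (fun y => expmx (psi n.+1 y)) x) ->
  (* S10 *)
  xi n.+1 = r n.+1 / Num.sqrt (EPh + B) ->
  (* S11 *)
  (forall x, Om x -> V n.+1 x = xi n.+1 * Vbar n.+1 x) ->
  let Eh := fun m : nat =>
    2^-1 * nrmv Om (u m) ^+ 2 + `|r m| ^+ 2
    + dt ^+ 2 / 2 * nrmv Om (egrad K (p m)) ^+ 2 in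
  (Eh n.+1 - Eh n) / dt
  <= - (Re^-1 * nrmt Om (egradv K (ubar n.+1)) ^+ 2)
     - `|r n.+1 / Num.sqrt (EPh + B)| ^+ 2 * (Co / Pe) *
       \sum_i \int[mu]_(x in Om)
         (c n.+1 i x *
          dotv (egrad K (fun y => ln (c n.+1 i y) + z i * Vbar n.+1 y) x)
               (egrad K (fun y => ln (c n.+1 i y) + z i * Vbar n.+1 y) x))
     - M / (2 * Wi) * `|r n.+1 / Num.sqrt (EPh + B)| ^+ 2 *
       \int[mu]_(x in Om) \tr (expmx (psi n.+1 x) + expmx (- psi n.+1 x) - 2%:M)
     - kap * M / 2 * `|r n.+1 / Num.sqrt (EPh + B)| ^+ 2 *
       \int[mu]_(x in Om)
         gradt_ddot K (psi n.+1) (fun y => expmx (psi n.+1 y)) x.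
Proof.
move=> mu EPh [[oOm _ _ bOm] _] _ _ _ _ _ _ _ _ _ _ dt0 _ _ _ _ _ _ un Mp _.
move=> _ _ _ _ Xub Mp' un' _ _ _ _ _ _ _ S6 S7 S8 S9 S10 _; cbv zeta.
have [[_ _ Pp] [_ _ Pp']] := (Mp, Mp').
have mOm := open_measurable_plane R Om oOm.
have fin := plane_bounded_finite_measure R Om mOm bOm.
have broken_L2v v : broken_poly Om K v -> L2v R Om v by move=> [k vk] i; case: (vk i).
have Lub : L2v R Om (ubar n.+1) by move=> i; case: (Xub i) => -[].
have Lg := P1_egrad_L2v R J K Om (p n) mOm fin Pp.
have Lg' := P1_egrad_L2v R J K Om (p n.+1) mOm fin Pp'.
(* The projection equation contains the gradient of the pressure increment, the velocity correction
   the difference of gradients; [egradB] reconciles them. *)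
have S7p := S7 _ Mp; have S7p' := S7 _ Mp'; rewrite !egradB// in S7p S7p'.
have := projection_energy _ _ _ _ _ _ _ _ mOm (lt0r_neq0 dt0) (broken_L2v _ un)
  (broken_L2v _ un') Lub Lg Lg' S8 S7p S7p'.
have := ipv_ge0 R Om (fun x => ubar n.+1 x - u n x); set dU := ipv _ _ _.
have := auxiliary_variable_energy _ _ _ _ _ _ dt0 S9.
have := S6 _ Xub.
move: (sqr_nrmv R Om (u n.+1)) (sqr_nrmv R Om (u n))
  (sqr_nrmt R Om (egradv K (ubar n.+1))).
move: (sqr_nrmv R Om (egrad K (p n.+1))) (sqr_nrmv R Om (egrad K (p n))).
move: (nrmv Om (u n.+1)) (nrmv Om (u n)) (nrmt Om (egradv K (ubar n.+1)))
  (nrmv Om (egrad K (p n.+1))) (nrmv Om (egrad K (p n))) => N1 N2 N3 N4 N5.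
rewrite -S10.
rewrite -/(ipv Om (convect K (u n)) (ubar n.+1)).
(* The elastic and electric integrals of the [r] equation are put in the form they have in the
   tested momentum equation, so that they can cancel. *)
have -> : \int[mu]_(x in Om) ddot (egradv K (ubar n.+1) x) (expmx (psi n.+1 x)) =
    ipt Om (fun x => expmx (psi n.+1 x)) (egradv K (ubar n.+1)).
  apply: eq_Rintegral => x _.
  by apply: eq_bigr => i _; apply: eq_bigr => j _; rewrite mulrC.
have -> : \int[mu]_(x in Om) (\sum_i Co * z i * c n.+1 i x *
      dotv (ubar n.+1 x) (egrad K (Vbar n.+1) x)) =
    ipv Om (fun x => \sum_i (Co * z i * c n.+1 i x) *: egrad K (Vbar n.+1) x)
      (ubar n.+1).
  apply: eq_Rintegral => x _; rewrite -mulr_suml -scaler_suml mulr_sumr.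
  by apply: eq_bigr => j _; rewrite !mxE mulrCA mulrA [_ * ubar _ _ _ _]mulrC mulrA.
(* Every integral is now abstracted to a real variable, leaving an inequality between polynomials in
   these reals, [dt] and its inverse. *)
clear -dt0.
move: (ipv Om (fun x => dt^-1 *: _) _) (ipv Om (egrad K (p n)) (ubar n.+1)).
move: (ipv Om (u n.+1) _) (ipv Om (u n) _) (ipv Om (egrad K (p n.+1)) _).
move: (ipv Om (egrad K (p n)) _) (ipv Om (convect _ _) _) (ipv Om (fun x => \sum_i _) _).
move: (ipt Om (egradv _ _) _) (ipt Om (fun x => expmx _) _) dU.
move: (\sum_i Rintegral _ _ _) (Rintegral _ _ (fun x => \tr _)).
move: (Rintegral _ _ _).
move: (xi n.+1) (r n.+1) (r n) (Co / Pe) (M / (2 * Wi)) => x r' r0 a b.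
move=> I3 I2 I1 I4 I5 dU G I6 I7 U' U G' Du Dp.
move=> N4E N5E N1E N2E N3E momentum auxiliary dU0 projection.
rewrite N1E N2E N3E N4E N5E !real_normK ?num_real//.
set LHS := (X in X <= _).
(* Dividing by [dt] brings the pressure weight [dt ^+ 2 / 2] to the [dt / 2] of the projection
   identity. *)
have -> : LHS = (2 * dt)^-1 * (U' - U) + (r' ^+ 2 - r0 ^+ 2) / dt + dt / 2 * (G' - G).
  by rewrite /LHS; field; exact: lt0r_neq0.
have : 0 <= (2 * dt)^-1 * dU by rewrite mulr_ge0// invr_ge0 mulr_ge0// ltW.
(* The products of [x] with the coupling integrals occur as identical monomials in [momentum] and
   [auxiliary], so the combination is linear in monomials. *)
move: momentum auxiliary projection; clear; lra.
Qed.
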